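(* Let $I$ and $O$ be sets, regarded as objects of the Markov category $\mathbf{Dist}$. Then the category $\mathbf{UnifilarComb}(I,O)$ in $\mathbf{Dist}$ has a terminal object $(T,\omega)$, given as follows. $T$ is the set of all output-first controlled stochastic processes in $\mathbf{Dist}$ with input space $I$ and output space $O$. The morphism $\omega\colon I\otimes T\to O\otimes T$ is composed of a readout map $\omega^\bullet\colon T\to O$ and an update map $u\colon O\otimes I\otimes T\to T$, in the sense that $$\omega(o,q\mid i,p)=\omega^\bullet(o\mid p)\,u(q\mid o,i,p),$$ where: - the readout map sends a controlled stochastic process $p$ to the distribution $p_1$ over $O$, i.e. $\omega^\bullet(o\mid p)=p_1(o)$; - given $i\in I$, $o\in O$ and $p\in T$, if $p_1(o)>0$ then $u(\cdot\mid o,i,p)$ is the delta distribution concentrated on the controlled stochastic process $p^{i,o}$ given, for $n\ge 1$, by $$p^{i,o}_n(o_0,\dots,o_{n-1}\mid i_1,\dots,i_{n-1})=\frac{1}{p_1(o)}\,p_{n+1}(o,o_0,\dots,o_{n-1}\mid i,i_1,\dots,i_{n-1}),$$ and if $p_1(o)=0$ then $u(\cdot\mid o,i,p)$ is an arbitrary distribution over controlled stochastic processes.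
   Context: **Dist.** $\mathbf{Dist}$ is the Kleisli category of the real-valued finitely supported distribution monad on sets: objects are sets, and a morphism $f\colon A\to B$ assigns to each $a\in A$ a finitely supported probability distribution $f(\cdot\mid a)$ on $B$; composition is $(f\mathbin{;}g)(c\mid a)=\sum_b f(b\mid a)g(c\mid b)$. It is a Markov category with $\otimes$ the cartesian product of sets, unit the one-point set, and the evident maps $\operatorname{copy}_X\colon X\to X\otimes X$ and $\operatorname{del}_X\colon X\to 1$. A morphism $f\colon A\to X$ is deterministic if $f\mathbin{;}\operatorname{copy}_X=\operatorname{copy}_A\mathbin{;}(f\otimes f)$, i.e. every $f(\cdot\mid a)$ is a delta distribution. **Deterministic given $X$.** For $f\colon A\to X\otimes Y$ write $f_X=f\mathbin{;}(\mathrm{id}_X\otimes\operatorname{del}_Y)$ and $\hat f=\operatorname{copy}_A\mathbin{;}(f_X\otimes\mathrm{id}_A)\mathbin{;}(\operatorname{copy}_X\otimes\mathrm{id}_A)\colon A\to X\otimes X\otimes A$. A conditional of $f$ is a morphism $c\colon X\otimes A\to Y$ with $f=\hat f\mathbin{;}(\mathrm{id}_X\otimes c)$, i.e. $f(x,y\mid a)=f_X(x\mid a)\,c(y\mid x,a)$. The morphism $f$ is deterministic given $X$ if for a conditional $c$ (equivalently, any conditional) of $f$ one has $\hat f\mathbin{;}(\mathrm{id}_X\otimes(c\mathbin{;}\operatorname{copy}_Y))=\hat f\mathbin{;}(\mathrm{id}_X\otimes(\operatorname{copy}_{X\otimes A}\mathbin{;}(c\otimes c)))$. In $\mathbf{Dist}$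 this means $c(\cdot\mid x,a)$ is a delta distribution whenever $f_X(x\mid a)>0$. **Machines.** A comb machine with input space $I$ and output space $O$ is an object $S$ (the state space) with a morphism $\alpha\colon I\otimes S\to O\otimes S$ and a morphism $\alpha^\bullet\colon S\to O$ (the readout map) such that $\alpha\mathbin{;}(\mathrm{id}_O\otimes\operatorname{del}_S)=\operatorname{del}_I\otimes\alpha^\bullet$. It is unifilar if $\alpha$ is deterministic given $O$. A morphism of unifilar comb machines $(S,\alpha)\to(T,\beta)$ is a deterministic morphism $f\colon S\to T$ with $\alpha\mathbin{;}(\mathrm{id}_O\otimes f)=(\mathrm{id}_I\otimes f)\mathbin{;}\beta$ and $f\mathbin{;}\beta^\bullet=\alpha^\bullet$. (The second equation follows from the first when $I$ is nonempty.) $\mathbf{UnifilarComb}(I,O)$ is the category of unifilar comb machines. **Controlled stochastic processes.** An output-first controlled stochastic process with input space $I$ and output space $O$ is a family of morphisms $p_n\colon I^{n-1}\to O^n$, $n\ge1$, written $p_n(o_0,\dots,o_{n-1}\mid i_1,\dots,i_{n-1})$ (inputs indexed from $1$, outputs from $0$), such that for every $n\ge 2$ discarding the last output of $p_n$ equals discarding the last input and applying $p_{n-1}$; in $\mathbf{Dist}$: $$\sum_{o_{n-1}\in O}p_n(o_0,\dots,o_{n-1}\mid i_1,\dots,i_{n-1})=p_{n-1}(o_0,\dots,o_{n-2}\mid i_1,\dots,i_{n-2}).$$ *)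

(* Defs.v *)
From HB Require Import structures.
From mathcomp Require Import all_boot all_order all_algebra.
From mathcomp Require Import all_classical all_reals.

Set Implicit Arguments.
Unset Strict Implicit.
Unset Printing Implicit Defensive.

Import Order.TTheory GRing.Theory Num.Theory.
Local Open Scope classical_set_scope.
Local Open Scope ring_scope.

Lemma fsumT_restrict (R : realType) (A : choiceType) (D : set A) (F : A -> R) :
  (forall a, ~ D a -> F a = 0) ->
  \sum_(a \in [set: A]) F a = \sum_(a \in D) F a.
Proof.
move=> F0; apply/esym/fsbig_widen => // a [_ nDa].
exact: F0.
Qed.

Lemma fsumT_pair (R : realType) (A B : choiceType) (D : set A) (E : set B)
    (F : A -> R) (G : B -> R) :
  finite_set D -> finite_set E ->
  (forall a, ~ D a -> F a = 0) -> (forall b, ~ E b -> G b = 0) ->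
  \sum_(x \in [set: A * B]) (F x.1 * G x.2) =
  (\sum_(a \in [set: A]) F a) * (\sum_(b \in [set: B]) G b).
Proof.
move=> fD fE F0 G0.
rewrite (fsumT_restrict F0) (fsumT_restrict G0).
rewrite (fsumT_restrict (D := D `*` E)); last first.
  move=> [a b] /= /not_andP[/F0->|/G0->]; first by rewrite mul0r.
  by rewrite mulr0.
rewrite -(pair_fsbig _ (fun a b => F a * G b)) // mulr_fsuml.
by apply: eq_fsbigr => a _; rewrite mulr_fsumr.
Qed.

(* The objects of Dist, i.e. sets, are rendered as choiceTypes; classically
   every type carries such a structure. The sums \sum_(a \in [set: A]) are
   sums over the support of the summand, which is finite wherever such a sum
   is used below (when it is infinite, the value is 0 by convention). *)

Record fdist (R : realType) (A : choiceType) := FDist {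
  pmf :> A -> R;
  pmf_ge0 : forall a, 0 <= pmf a;
  pmf_finite : finite_set [set a | pmf a != 0];
  pmf_sum1 : \sum_(a \in [set: A]) pmf a = 1 }.

Lemma fdist_ext (R : realType) (A : choiceType) (p q : fdist R A) :
  p =1 q -> p = q.
Proof.
case: p q => [p p0 pf p1] [q q0 qf q1] /= /funext pq.
move: p0 pf p1; rewrite {}pq => p0 pf p1.
by congr FDist; exact: Prop_irrelevance.
Qed.

Definition kernel (R : realType) (A B : choiceType) := A -> fdist R B.

Lemma kernel_ext (R : realType) (A B : choiceType) (f g : kernel R A B) :
  (forall a b, f a b = g a b) -> f = g.
Proof. by move=> fg; apply/funext => a; exact/fdist_ext/fg. Qed.

Lemma pmf_out (R : realType) (A : choiceType) (p : fdist R A) a :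
  ~ [set x | p x != 0] a -> p a = 0.
Proof. by move=> /= /negP; rewrite negbK => /eqP. Qed.

Section Dirac.
Variables (R : realType) (A : choiceType) (a : A).

Let f (x : A) : R := (x == a)%:R.

Let f_ge0 x : 0 <= f x.
Proof. exact: ler0n. Qed.

Let f_finite : finite_set [set x | f x != 0].
Proof.
apply: (@sub_finite_set _ _ [set a]); last exact: finite_set1.
by move=> x /=; rewrite /f; case: (x =P a) => // _; rewrite eqxx.
Qed.

Let f_sum1 : \sum_(x \in [set: A]) f x = 1.
Proof.
rewrite (fsumT_restrict (D := [set a])) ?fsbig_set1 /f ?eqxx// => x /= /eqP.
by move=> /negbTE ->.
Qed.

Definition dirac : fdist R A := FDist f_ge0 f_finite f_sum1.
End Dirac.
Arguments dirac R {A} a.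

Definition detk (R : realType) (A B : choiceType) (h : A -> B) : kernel R A B :=
  fun a => dirac R (h a).
Arguments detk R {A B} h.

Section Comp.
Variables (R : realType) (A B C : choiceType).
Variables (f : kernel R A B) (g : kernel R B C) (a : A).

Let h (c : C) : R := \sum_(b \in [set: B]) (f a b * g b c).

Let S := [set b | f a b != 0].

Let hE c : h c = \sum_(b \in S) (f a b * g b c).
Proof. by apply: fsumT_restrict => b nSb; rewrite [f a b]pmf_out ?mul0r. Qed.

Let h_ge0 c : 0 <= h c.
Proof. by apply: fsumr_ge0 => b _; apply: mulr_ge0; exact: pmf_ge0. Qed.

Let U := \bigcup_(b in S) [set c | g b c != 0].

Let U_finite : finite_set U.
Proof.
by apply: bigcup_finite => [|b _]; exact: pmf_finite.
Qed.

Let h_out c : ~ U c -> h c = 0.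
Proof.
move=> nU; rewrite hE; apply: fsbig1 => b Sb.
by rewrite [g b c]pmf_out ?mulr0// => gbc; apply: nU; exists b.
Qed.

Let h_finite : finite_set [set c | h c != 0].
Proof.
apply: (sub_finite_set _ U_finite) => c /= hc.
by apply: contrapT => /h_out h0; rewrite h0 eqxx in hc.
Qed.

Let h_sum1 : \sum_(c \in [set: C]) h c = 1.
Proof.
rewrite (fsumT_restrict h_out).
under eq_fsbigr do rewrite hE.
rewrite exchange_fsbig //; last exact: pmf_finite.
rewrite -(pmf_sum1 (f a)) (fsumT_restrict (@pmf_out _ _ (f a))).
apply: eq_fsbigr => b; rewrite inE => Sb.
rewrite -mulr_fsumr -[RHS]mulr1; congr (_ * _).
rewrite -(pmf_sum1 (g b)); apply/esym/fsumT_restrict => c nU.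
by apply: pmf_out => gbc; apply: nU; exists b.
Qed.

Definition kcomp_dist : fdist R C := FDist h_ge0 h_finite h_sum1.
End Comp.

Definition kcomp (R : realType) (A B C : choiceType)
  (f : kernel R A B) (g : kernel R B C) : kernel R A C := kcomp_dist f g.

Section Tensor.
Variables (R : realType) (A B C D : choiceType).
Variables (f : kernel R A B) (g : kernel R C D) (x : A * C).

Let h (y : B * D) : R := f x.1 y.1 * g x.2 y.2.

Let h_ge0 y : 0 <= h y.
Proof. by apply: mulr_ge0; exact: pmf_ge0. Qed.

Let h_finite : finite_set [set y | h y != 0].
Proof.
apply: (@sub_finite_set _ _
  ([set b | f x.1 b != 0] `*` [set d | g x.2 d != 0])).
  by move=> y /=; rewrite mulf_eq0 negb_or => /andP[].
by apply: finite_setX; exact: pmf_finite.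
Qed.

Let h_sum1 : \sum_(y \in [set: B * D]) h y = 1.
Proof.
rewrite (fsumT_pair (pmf_finite (f x.1)) (pmf_finite (g x.2))).
- by rewrite !pmf_sum1 mulr1.
- by move=> b; exact: pmf_out.
- by move=> d; exact: pmf_out.
Qed.

Definition tensor_dist : fdist R (B * D)%type := FDist h_ge0 h_finite h_sum1.
End Tensor.

Definition tensor (R : realType) (A B C D : choiceType)
  (f : kernel R A B) (g : kernel R C D) :
  kernel R (A * C)%type (B * D)%type := tensor_dist f g.

Declare Scope dist_scope.
Delimit Scope dist_scope with dist.
Bind Scope dist_scope with kernel.
Notation "f ;; g" := (kcomp f g)
  (at level 60, right associativity) : dist_scope.
Notation "f ⊗ g" := (tensor f g)
  (at level 45, right associativity) : dist_scope.
Local Open Scope dist_scope.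

Definition idk (R : realType) (A : choiceType) : kernel R A A := detk R id.
Definition copyk (R : realType) (A : choiceType) : kernel R A (A * A)%type :=
  detk R (fun a => (a, a)).
Definition delk (R : realType) (A : choiceType) : kernel R A unit :=
  detk R (fun=> tt).

Definition assock (R : realType) (A B C : choiceType) :
  kernel R ((A * B) * C)%type (A * (B * C))%type :=
  detk R (fun x => (x.1.1, (x.1.2, x.2))).
Definition lunitk (R : realType) (A : choiceType) :
  kernel R (unit * A)%type A := detk R snd.
Definition runitk (R : realType) (A : choiceType) :
  kernel R (A * unit)%type A := detk R fst.

Arguments idk R A : clear implicits.
Arguments copyk R A : clear implicits.
Arguments delk R A : clear implicits.
Arguments assock R A B C : clear implicits.
Arguments lunitk R A : clear implicits.
Arguments runitk R A : clear implicits.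

Lemma kcomp_idl (R : realType) (A B : choiceType) (f : kernel R A B) :
  idk R A ;; f = f.
Proof.
apply: kernel_ext => a b; rewrite /= (fsumT_restrict (D := [set a])).
  by rewrite fsbig_set1 eqxx mul1r.
by move=> x /= /eqP /negbTE ->; rewrite mul0r.
Qed.

Lemma kcomp_idr (R : realType) (A B : choiceType) (f : kernel R A B) :
  f ;; idk R B = f.
Proof.
apply: kernel_ext => a b; rewrite /= (fsumT_restrict (D := [set b])).
  by rewrite fsbig_set1 eqxx mulr1.
by move=> x /= /eqP; rewrite eq_sym => /negbTE ->; rewrite mulr0.
Qed.

Lemma kcompA (R : realType) (A B C D : choiceType)
    (f : kernel R A B) (g : kernel R B C) (h : kernel R C D) :
  f ;; (g ;; h) = (f ;; g) ;; h.
Proof.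
apply: kernel_ext => a d /=.
set S := [set b | f a b != 0].
set U := \bigcup_(b in S) [set c | g b c != 0].
have fS : finite_set S by exact: pmf_finite.
have fU : finite_set U by apply: bigcup_finite => // b _; exact: pmf_finite.
have S0 b : ~ S b -> f a b = 0 by exact: pmf_out.
have U0 b c : S b -> ~ U c -> g b c = 0.
  by move=> Sb nU; apply: pmf_out => gbc; apply: nU; exists b.
rewrite (fsumT_restrict (D := S)); last by move=> b /S0 ->; rewrite mul0r.
rewrite [RHS](fsumT_restrict (D := U)); last first.
  move=> c nU; rewrite fsbig1 ?mul0r// => b _.
  have [/U0 ->//|/S0 ->] := pselect (S b); first by rewrite mulr0.
  by rewrite mul0r.
transitivity (\sum_(b \in S) \sum_(c \in U) (f a b * g b c * h c d)).
  apply: eq_fsbigr => b; rewrite inE => Sb.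
  rewrite (fsumT_restrict (D := U)).
    by rewrite mulr_fsumr; apply: eq_fsbigr => c _; rewrite mulrA.
  by move=> c /(U0 _ _ Sb) ->; rewrite mul0r.
rewrite exchange_fsbig //; apply: eq_fsbigr => c _.
rewrite -mulr_fsuml; congr (_ * _); apply/esym/fsumT_restrict => b /S0 ->.
by rewrite mul0r.
Qed.

Lemma tensor_id (R : realType) (A B : choiceType) :
  idk R A ⊗ idk R B = idk R (A * B)%type.
Proof.
by apply: kernel_ext => -[a b] [c d] /=; rewrite -natrM mulnb.
Qed.

Lemma tensor_comp (R : realType) (A B C A' B' C' : choiceType)
    (f : kernel R A B) (g : kernel R B C)
    (f' : kernel R A' B') (g' : kernel R B' C') :
  (f ;; g) ⊗ (f' ;; g') = (f ⊗ f') ;; (g ⊗ g').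
Proof.
apply: kernel_ext => -[a a'] [c c'] /=.
rewrite -(fsumT_pair (pmf_finite (f a)) (pmf_finite (f' a'))).
- by apply: eq_fsbigr => -[b b'] _ /=; rewrite mulrACA.
- by move=> b nb; rewrite [f a b]pmf_out ?mul0r.
- by move=> b nb; rewrite [f' a' b]pmf_out ?mul0r.
Qed.

Definition deterministic (R : realType) (A X : choiceType) (f : kernel R A X) :
  Prop := f ;; copyk R X = copyk R A ;; (f ⊗ f).

Definition marginal (R : realType) (A X Y : choiceType)
  (f : kernel R A (X * Y)%type) : kernel R A X :=
  f ;; (idk R X ⊗ delk R Y) ;; runitk R X.

Definition hat (R : realType) (A X Y : choiceType)
  (f : kernel R A (X * Y)%type) : kernel R A (X * (X * A))%type :=
  copyk R A ;; (marginal f ⊗ idk R A) ;; (copyk R X ⊗ idk R A)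
  ;; assock R X X A.

Definition is_conditional (R : realType) (A X Y : choiceType)
  (f : kernel R A (X * Y)%type) (c : kernel R (X * A)%type Y) : Prop :=
  f = hat f ;; (idk R X ⊗ c).

(* Every f has a conditional, and the equation below holds for one conditional
   of f iff it holds for all of them. *)
Definition deterministic_given (R : realType) (A X Y : choiceType)
  (f : kernel R A (X * Y)%type) : Prop :=
  exists c : kernel R (X * A)%type Y,
    is_conditional f c /\
    hat f ;; (idk R X ⊗ (c ;; copyk R Y)) =
    hat f ;; (idk R X ⊗ (copyk R (X * A)%type ;; (c ⊗ c))).

Record category := Category {
  obj :> Type;
  hom : obj -> obj -> Type;
  cid : forall a, hom a a;
  ccomp : forall a b c, hom a b -> hom b c -> hom a c;
  ccomp_idl : forall a b (f : hom a b), ccomp (cid a) f = f;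
  ccomp_idr : forall a b (f : hom a b), ccomp f (cid b) = f;
  ccompA : forall a b c d (f : hom a b) (g : hom b c) (h : hom c d),
    ccomp f (ccomp g h) = ccomp (ccomp f g) h }.
Arguments hom {c0} _ _ : rename.

Definition terminal (C : category) (t : C) : Prop :=
  forall a : C, exists f : hom a t, forall g : hom a t, g = f.

Definition is_readout (R : realType) (I O S : choiceType)
  (step : kernel R (I * S)%type (O * S)%type) (readout : kernel R S O) : Prop :=
  step ;; (idk R O ⊗ delk R S) ;; runitk R O =
  (delk R I ⊗ readout) ;; lunitk R O.

Record comb (R : realType) (I O : choiceType) := Comb {
  state : choiceType;
  step : kernel R (I * state)%type (O * state)%type;
  readout : kernel R state O;
  stepP : is_readout step readout }.
Arguments state {R I O} _.
Arguments step {R I O} _ _.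
Arguments readout {R I O} _ _.

Definition unifilar (R : realType) (I O : choiceType) (M : comb R I O) : Prop :=
  deterministic_given (step M).

Record unifilar_comb (R : realType) (I O : choiceType) := UnifilarComb {
  ucomb :> comb R I O;
  unifilarP : unifilar ucomb }.

Record comb_hom (R : realType) (I O : choiceType) (M N : unifilar_comb R I O) :=
  CombHom {
  hom_kernel :> kernel R (state M) (state N);
  hom_det : deterministic hom_kernel;
  hom_step : step M ;; (idk R O ⊗ hom_kernel) =
             (idk R I ⊗ hom_kernel) ;; step N;
  hom_readout : hom_kernel ;; readout N = readout M }.
Arguments hom_kernel {R I O M N} _ _.

Lemma comb_hom_ext (R : realType) (I O : choiceType)
    (M N : unifilar_comb R I O) (f g : comb_hom M N) :
  hom_kernel f = hom_kernel g -> f = g.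
Proof.
case: f g => [f f1 f2 f3] [g g1 g2 g3] /= fg.
move: f1 f2 f3; rewrite fg => f1 f2 f3.
by congr CombHom; exact: Prop_irrelevance.
Qed.

Section UnifilarCombCategory.
Variables (R : realType) (I O : choiceType).
Implicit Types M N P : unifilar_comb R I O.

Let id_det M : deterministic (idk R (state M)).
Proof. by rewrite /deterministic kcomp_idl tensor_id kcomp_idr. Qed.

Let id_step M : step M ;; (idk R O ⊗ idk R (state M)) =
  (idk R I ⊗ idk R (state M)) ;; step M.
Proof. by rewrite !tensor_id kcomp_idl kcomp_idr. Qed.

Definition comb_id M : comb_hom M M :=
  CombHom (@id_det M) (id_step M) (kcomp_idl _).

Section CombComp.
Variables (M N P : unifilar_comb R I O) (f : comb_hom M N) (g : comb_hom N P).

Let comp_det : deterministic (f ;; g).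
Proof.
rewrite /deterministic -kcompA (hom_det g) kcompA (hom_det f) -kcompA.
by rewrite -tensor_comp.
Qed.

Let comp_step : step M ;; (idk R O ⊗ (f ;; g)) =
  (idk R I ⊗ (f ;; g)) ;; step P.
Proof.
have split X : idk R X ⊗ (f ;; g) = (idk R X ⊗ f) ;; (idk R X ⊗ g).
  by rewrite -tensor_comp kcomp_idl.
rewrite (split I) (split O) kcompA (hom_step f) -[LHS]kcompA (hom_step g).
exact: kcompA.
Qed.

Let comp_readout : (f ;; g) ;; readout P = readout M.
Proof. by rewrite -kcompA !hom_readout. Qed.

Definition comb_comp : comb_hom M P := CombHom comp_det comp_step comp_readout.
End CombComp.

Let comb_idl M N (f : comb_hom M N) : comb_comp (comb_id M) f = f.
Proof. exact/comb_hom_ext/kcomp_idl. Qed.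

Let comb_idr M N (f : comb_hom M N) : comb_comp f (comb_id N) = f.
Proof. exact/comb_hom_ext/kcomp_idr. Qed.

Let combA M N P Q (f : comb_hom M N) (g : comb_hom N P)
    (h : comb_hom P Q) :
  comb_comp f (comb_comp g h) = comb_comp (comb_comp f g) h.
Proof. exact/comb_hom_ext/kcompA. Qed.

Definition UnifilarCombCat : category := Category comb_idl comb_idr combA.
End UnifilarCombCategory.
Arguments UnifilarCombCat : clear implicits.

(* On inputs of length n, [proc] is the morphism p_(n+1) : I^n -> O^(n+1). *)
Record csp (R : realType) (I O : choiceType) := Csp {
  proc : forall n, kernel R (n.-tuple I) (n.+1.-tuple O);
  proc_consistent : forall n (i : n.-tuple I) (iN : I) (o : n.+1.-tuple O),
    \sum_(oN \in [set: O]) proc [tuple of rcons i iN] [tuple of rcons o oN]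
    = proc i o }.
Arguments proc {R I O} _ {n} _.

HB.instance Definition _ (R : realType) (I O : choiceType) :=
  gen_eqMixin (csp R I O).
HB.instance Definition _ (R : realType) (I O : choiceType) :=
  gen_choiceMixin (csp R I O).

Definition first_output (R : realType) (I O : choiceType)
  (p : csp R I O) (o : O) : R := proc p [tuple] [tuple o].

(* [q] is the process written p^(i,o); this is meaningful when
   [first_output p o] is positive. *)
Definition is_shift (R : realType) (I O : choiceType)
  (i : I) (o : O) (p q : csp R I O) : Prop :=
  forall n (ins : n.-tuple I) (outs : n.+1.-tuple O),
    proc q ins outs =
    (first_output p o)^-1 *
    proc p [tuple of i :: ins] [tuple of o :: outs].

Definition is_update (R : realType) (I O : choiceType)
  (u : kernel R (O * I * csp R I O)%type (csp R I O)) : Prop :=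
  forall (o : O) (i : I) (p : csp R I O), 0 < first_output p o ->
    exists q : csp R I O, is_shift i o p q /\ u (o, i, p) = dirac R q.

(* Main.v *)
Require Import Defs.
From mathcomp Require Import all_boot all_order all_algebra.
From mathcomp Require Import all_classical all_reals.
Local Open Scope ring_scope.

Import Order.TTheory GRing.Theory Num.Theory.
Local Open Scope classical_set_scope.
Local Open Scope dist_scope.

(** A unifilar machine is, up to the steps of probability zero, an ordinary
    deterministic transition system with randomly chosen outputs: there is a
    function [next] such that [step (o, s' | i, s)] is [readout (o | s)] when
    [s' = next o i s] and zero otherwise ([unifilar_next]).

    Such a machine has a behaviour at each state [s], namely the process whose
    probabilities are the products of the readouts along the only trajectory
    from [s] compatible with the given inputs and outputs ([behaviour]). The
    first output of [behaviour s] has the law [readout s], and once [o] has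
    been output and [i] received, the conditioned process
    [(behaviour s)^(i,o)] is [behaviour (next o i s)]. Conversely these two
    facts determine the behaviour by induction on the length of the outputs
    ([behaviour_unique]); the outputs whose head has probability zero carry no
    information, since by consistency every continuation of an impossible
    output is impossible ([proc_head_eq0]).

    On the side of processes, conditioning a process on its first output gives
    again a process because consistency, applied repeatedly to the last
    output, shows that the law of the first output is the same at every length
    and for all inputs ([proc_head_marginal]); this normalizes the quotient
    defining [p^(i,o)] ([shift_exists]).

    A morphism of machines into the machine of processes is deterministic,
    hence given by a function [h] on states ([deterministic_detk]). Preservation
    of readouts says that [h s] has first output law [readout s], and
    preservation of steps says that, wherever the output [o] is possible,
    [h (next o i s)] is the conditioned process [(h s)^(i,o)]. These are the
    two properties that characterize the behaviour, so [behaviour] is the one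
    morphism into the machine of processes ([csp_terminal]). The values of the
    update on impossible outputs are multiplied by zero throughout, which is
    why they may be arbitrary. *)

Set Implicit Arguments.
Unset Strict Implicit.

(** * Finitely supported sums *)

Section FiniteSums.
Variable R : realType.

Lemma fsum_single (A : choiceType) (a : A) (F : A -> R) :
  (forall x, x != a -> F x = 0) -> \sum_(x \in [set: A]) F x = F a.
Proof.
move=> F0; rewrite (fsumT_restrict (D := [set a])) ?fsbig_set1//.
by move=> x /= /eqP; exact: F0.
Qed.

Lemma fsum_eq0_term (A : choiceType) (F : A -> R) (a : A) :
  finite_set [set x | F x != 0] -> (forall x, 0 <= F x) ->
  \sum_(x \in [set: A]) F x = 0 -> F a = 0.
Proof.
move=> fF F0; rewrite (fsumT_restrict (D := [set x | F x != 0])); last first.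
  by move=> x /= /negP; rewrite negbK => /eqP.
move=> /(pfsumr_eq0 fF (fun x _ => F0 x)) F1.
by apply/eqP/negPn/negP => Fa; move/eqP: (Fa); apply; exact: F1.
Qed.

(** Only the support on the product is assumed finite: its two projections are
    finite sets outside which all the inner sums vanish. *)
Lemma fsum_fubini (A B : choiceType) (F : A * B -> R) :
  finite_set [set x | F x != 0] ->
  \sum_(x \in [set: A * B]) F x =
  \sum_(a \in [set: A]) \sum_(b \in [set: B]) F (a, b).
Proof.
set S := [set x | _] => fS.
have nS x : ~ S x -> F x = 0 by move=> /negP; rewrite negbK => /eqP.
have nD a b : ~ (fst @` S) a -> F (a, b) = 0.
  by move=> nDa; apply: nS => Sab; apply: nDa; exists (a, b).
have nE a b : ~ (snd @` S) b -> F (a, b) = 0.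
  by move=> nEb; apply: nS => Sab; apply: nEb; exists (a, b).
rewrite (fsumT_restrict (D := (fst @` S) `*` (snd @` S))); last first.
  by move=> [a b] /= /not_andP[/nD|/nE].
rewrite [RHS](fsumT_restrict (D := fst @` S)); last first.
  by move=> a nDa; apply: fsbig1 => b _; exact: nD.
under [RHS]eq_fsbigr do rewrite (fsumT_restrict (fun b => @nE _ b)).
rewrite (pair_fsbig _ (fun a b => F (a, b))); try exact: finite_image.
by apply: eq_fsbigr => -[].
Qed.

Lemma rcons_tuple_bij (A : Type) n :
  bijective (fun x : n.-tuple A * A => [tuple of rcons x.1 x.2]).
Proof.
exists (fun t : n.+1.-tuple A => ([tuple of belast (thead t) (behead t)],
                                  last (thead t) (behead t))).
  move=> [t a] /=; congr (_, _).
    apply: val_inj => /=; case: t => -[|x s] sz //=.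
    by rewrite belast_rcons.
  by case: t => -[|x s] sz //=; rewrite last_rcons.
move=> t; apply: val_inj => /=.
by rewrite [t in RHS]tuple_eta /= lastI.
Qed.

Lemma fsum_rcons (A : choiceType) n (F : n.+1.-tuple A -> R) :
  finite_set [set t | F t != 0] ->
  \sum_(t \in [set: n.+1.-tuple A]) F t =
  \sum_(t \in [set: n.-tuple A]) \sum_(a \in [set: A])
    F [tuple of rcons t a].
Proof.
move=> fF; rewrite (reindex_fsbigT _ F (rcons_tuple_bij A n)) fsum_fubini//.
apply: (finite_preimage (B := [set t | F t != 0])) => //.
by move=> x y _ _; exact: (bij_inj (rcons_tuple_bij A n)).
Qed.

End FiniteSums.

(** * Finitely supported distributions *)

Section Distributions.
Variable R : realType.

(** A single distribution is treated as a kernel with constant value, so that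
    pushforwards and joint laws are instances of kernel composition and need no
    new proof of normalization. *)
Definition image_dist (A B : choiceType) (h : A -> B) (p : fdist R A) :
  fdist R B := kcomp_dist (fun=> p) (detk R h) tt.

Lemma image_distE (A B : choiceType) (h : A -> B) (p : fdist R A) a :
  injective h -> image_dist h p (h a) = p a.
Proof.
move=> hI; rewrite /= (@fsum_single _ _ a) ?eqxx ?mulr1// => x xa.
by rewrite (inj_eq hI) eq_sym (negbTE xa) mulr0.
Qed.

Definition joint (A B : choiceType) (p : fdist R A) (k : A -> fdist R B) :
  fdist R (A * B)%type :=
  kcomp_dist (fun=> p) (fun a => tensor_dist (idk R A) k (a, a)) tt.

Lemma jointE (A B : choiceType) (p : fdist R A) (k : A -> fdist R B) a b :
  joint p k (a, b) = p a * k a b.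
Proof.
rewrite /= (@fsum_single _ _ a) /= ?eqxx ?mul1r// => x xa.
by rewrite eq_sym (negbTE xa) mul0r mulr0.
Qed.

(** This is the pointwise content of both notions of determinism: the equation
    between [p] followed by copying and two independent draws from [p]. On the
    diagonal it says that each probability is its own square, and off the
    diagonal that no two points have positive probability. *)
Lemma idempotent_dirac (A : choiceType) (p : fdist R A) :
  (forall a b, p a * (b == a)%:R = p a * p b) -> exists a, p = dirac R a.
Proof.
move=> pp; have [a pa] : exists a, p a != 0.
  apply: contrapT => /forallNP p0; have := pmf_sum1 p.
  rewrite fsbig1 => [/esym/eqP|a _]; first by rewrite oner_eq0.
  by have /negP := p0 a; rewrite negbK => /eqP.
by exists a; apply: fdist_ext => b; apply: (mulfI pa); rewrite -pp.
Qed.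

End Distributions.

(** * Kernels and determinism given an output *)

Section Kernels.
Variable R : realType.

Lemma detk_comp (A B C : choiceType) (h : A -> B) (g : kernel R B C) a :
  (detk R h ;; g) a = g (h a).
Proof.
apply: fdist_ext => c; rewrite /= (@fsum_single _ _ (h a)) ?eqxx ?mul1r//.
by move=> b /negbTE ->; rewrite mul0r.
Qed.

Lemma tensor_detk (A B C D : choiceType) (f : A -> B) (g : C -> D) :
  detk R f ⊗ detk R g = detk R (fun x => (f x.1, g x.2)).
Proof.
by apply: kernel_ext => -[a c] [b d] /=; rewrite -natrM mulnb.
Qed.

Lemma comp_copyE (A B : choiceType) (f : kernel R A B) a b b' :
  (f ;; copyk R B) a (b, b') = f a b * (b' == b)%:R.
Proof.
rewrite /= (@fsum_single _ _ b) => [|x /negbTE xb].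
  by congr (_ * _); rewrite -[(b, b') == _]/((b == b) && _) eqxx.
by rewrite -[(b, b') == _]/((b == x) && _) eq_sym xb mulr0.
Qed.

Lemma deterministic_detk (A B : choiceType) (f : kernel R A B) :
  deterministic f -> exists h : A -> B, f = detk R h.
Proof.
move=> fD; suff /choice[h fh] : forall a, exists b, f a = dirac R b.
  by exists h; apply/funext.
move=> a; apply: idempotent_dirac => b b'.
by rewrite -comp_copyE fD detk_comp.
Qed.

Lemma detk_deterministic (A B : choiceType) (h : A -> B) :
  deterministic (detk R h).
Proof.
by rewrite /deterministic tensor_detk; apply/funext => a; rewrite !detk_comp.
Qed.

Lemma marginalE (A X Y : choiceType) (f : kernel R A (X * Y)%type) a x :
  marginal f a x = \sum_(y \in [set: Y]) f a (x, y).
Proof.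
rewrite /marginal tensor_detk.
have -> : detk R (fun z : X * Y => (id z.1, tt)) ;; runitk R X
          = detk R fst by apply/funext => z; rewrite detk_comp.
rewrite /= fsum_fubini; last first.
  apply: sub_finite_set (pmf_finite (f a)) => z /=.
  by apply: contra_neq => ->; rewrite mul0r.
rewrite (@fsum_single _ _ x) => [|x' xx'].
  by apply: eq_fsbigr => y _ /=; rewrite eqxx mulr1.
by apply: fsbig1 => y _; rewrite /= eq_sym (negbTE xx') mulr0.
Qed.

(** All the plumbing in [hat] only makes copies, so a composite after [hat f] is
    the marginal of [f] times the kernel evaluated at the copied data. *)
Lemma hat_compE (A X Y Z : choiceType) (f : kernel R A (X * Y)%type)
    (k : kernel R (X * A)%type Z) a x z :
  (hat f ;; (idk R X ⊗ k)) a (x, z) = marginal f a x * k (x, a) z.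
Proof.
rewrite /hat -!kcompA detk_comp tensor_detk.
have -> : detk R (fun w : X * A => ((w.1, w.1), id w.2)) ;;
          (assock R X X A ;; (idk R X ⊗ k)) =
          (fun w => (idk R X ⊗ k) (w.1, (w.1, w.2))).
  by apply/funext => w; rewrite detk_comp /assock detk_comp.
rewrite [LHS](@fsum_single _ _ (x, a)) => [|[x' a'] xa].
  by rewrite /= !eqxx mulr1 mul1r.
rewrite /=; have [xx|] := eqVneq x x'; last by rewrite mul0r mulr0.
have [aa|] := eqVneq a' a; last by rewrite mulr0 mul0r.
by rewrite xx aa eqxx in xa.
Qed.

Lemma kernel_pair_ext (A X Y : choiceType) (f g : kernel R A (X * Y)%type) :
  (forall a x y, f a (x, y) = g a (x, y)) -> f = g.
Proof. by move=> fg; apply: kernel_ext => a [x y]. Qed.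

(** Where [marginal f a x] is positive it can be cancelled, and the equation
    defining determinism given [X] makes the conditional a delta distribution.
    Elsewhere both sides are zero for any value of [h], and [y0] supplies one. *)
Lemma deterministic_given_next (A X Y : choiceType)
    (f : kernel R A (X * Y)%type) (y0 : A -> Y) :
  deterministic_given f -> exists h : X -> A -> Y, forall a x y,
    f a (x, y) = marginal f a x * (y == h x a)%:R.
Proof.
move=> [c [fc cD]].
suff /choice[h hP] : forall xa : X * A, exists y, forall y',
    f xa.2 (xa.1, y') = marginal f xa.2 xa.1 * (y' == y)%:R.
  by exists (fun x a => h (x, a)) => a x y; exact: hP (x, a) y.
move=> [x a]; rewrite -[(x, a).1]/x -[(x, a).2]/a.
have fE y : f a (x, y) = marginal f a x * c (x, a) y.
  by rewrite [in LHS]fc hat_compE.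
have [m0|m0] := eqVneq (marginal f a x) 0.
  by exists (y0 a) => y; rewrite fE m0 !mul0r.
have [|y cy] := @idempotent_dirac _ _ (c (x, a)); last first.
  by exists y => y'; rewrite fE cy.
move=> y y'; rewrite -comp_copyE; apply: (mulfI m0).
by rewrite -hat_compE cD hat_compE detk_comp.
Qed.

Lemma deterministic_given_intro (A X Y : choiceType)
    (f : kernel R A (X * Y)%type) (c : kernel R (X * A)%type Y) :
  (forall a x y, f a (x, y) = marginal f a x * c (x, a) y) ->
  (forall a x, marginal f a x != 0 -> exists y, c (x, a) = dirac R y) ->
  deterministic_given f.
Proof.
move=> fE cD; exists c; split.
  by apply: kernel_pair_ext => a x y; rewrite hat_compE.
apply: kernel_pair_ext => a x [y y']; rewrite !hat_compE.
have [->|/cD[z cz]] := eqVneq (marginal f a x) 0; first by rewrite !mul0r.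
congr (_ * _); rewrite comp_copyE detk_comp /= cz /=.
by have [->|] := eqVneq y z; rewrite ?mul0r// !mul1r.
Qed.

(** The right-hand side of the readout equation forgets the input, so the
    equation says that the output law of a step from [s] is [r s] whatever the
    input. *)
Lemma readoutE (I O S : choiceType)
    (step : kernel R (I * S)%type (O * S)%type) (r : kernel R S O) :
  is_readout step r <-> forall i s o, marginal step (i, s) o = r s o.
Proof.
have E i s : ((delk R I ⊗ r) ;; lunitk R O) (i, s) = r s.
  apply: fdist_ext => o; rewrite /= (@fsum_single _ _ (tt, o)) /=.
    by rewrite !eqxx mul1r mulr1.
  move=> [[] o'] oo'; have [oE|] := eqVneq o o'; last by rewrite mulr0.
  by rewrite oE eqxx in oo'.
rewrite /is_readout -/(marginal step); split=> [sr i s o|sr].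
  by rewrite -(E i) -sr /marginal kcompA.
apply: kernel_ext => -[i s] o; rewrite E -(sr i) /marginal.
by rewrite kcompA.
Qed.

End Kernels.

(** * Conditioning a process on its first output *)

Section Processes.
Variables (R : realType) (I O : choiceType).
Implicit Types p q : csp R I O.

Lemma csp_ext p q :
  (forall n (ins : n.-tuple I) outs, proc p ins outs = proc q ins outs) ->
  p = q.
Proof.
case: p q => [p pC] [q qC] /= pq.
have {}pq : p = q.
  by apply: functional_extensionality_dep => n; exact: kernel_ext.
by move: pC qC; rewrite pq => pC qC; congr Csp; exact: Prop_irrelevance.
Qed.

(** Consistency removes the last output together with the last input; repeating
    this until only the first output is left shows that its law depends neither
    on the inputs nor on the length. *)
Lemma proc_head_marginal p n (ins : n.-tuple I) o :
  \sum_(t \in [set: n.-tuple O]) proc p ins [tuple of o :: t] =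
  first_output p o.
Proof.
elim: n ins => [ins|n IH ins].
  rewrite (@fsum_single _ _ [tuple]) => [|t]; last by rewrite [t]tuple0 eqxx.
  by rewrite [ins]tuple0.
have [g _ gK] := rcons_tuple_bij I n; rewrite -(gK ins).
case: (g ins) => {}ins i; rewrite fsum_rcons /=; last first.
  apply: (finite_preimage (f := fun t : n.+1.-tuple O => [tuple of o :: t]) _
    (pmf_finite (proc p [tuple of rcons ins i]))).
  by move=> t t' _ _ [tt']; exact: val_inj.
rewrite -(IH ins); apply: eq_fsbigr => t _.
rewrite -(proc_consistent p ins i); apply: eq_fsbigr => a _.
by congr (proc p _ _); exact: val_inj.
Qed.

Lemma proc_head_eq0 p n (ins : n.-tuple I) o (t : n.-tuple O) :
  first_output p o = 0 -> proc p ins [tuple of o :: t] = 0.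
Proof.
rewrite -(proc_head_marginal p ins); apply: fsum_eq0_term => [|x].
  apply: (finite_preimage (f := fun t : n.-tuple O => [tuple of o :: t]) _
    (pmf_finite (proc p ins))).
  by move=> x y _ _ [xy]; exact: val_inj.
exact: pmf_ge0.
Qed.

Section Shift.
Variables (p : csp R I O) (i : I) (o : O).
Hypothesis po : 0 < first_output p o.

Let f n (ins : n.-tuple I) (outs : n.+1.-tuple O) : R :=
  (first_output p o)^-1 * proc p [tuple of i :: ins] [tuple of o :: outs].

Let f_ge0 n (ins : n.-tuple I) outs : 0 <= f ins outs.
Proof. by apply: mulr_ge0; [rewrite invr_ge0 ltW|exact: pmf_ge0]. Qed.

Let f_finite n (ins : n.-tuple I) : finite_set [set t | f ins t != 0].
Proof.
apply: sub_finite_set (finite_preimage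
  (f := fun t : n.+1.-tuple O => [tuple of o :: t]) _
  (pmf_finite (proc p [tuple of i :: ins]))).
  by move=> t /=; apply: contra_neq => t0; rewrite /f t0 mulr0.
by move=> x y _ _ [xy]; exact: val_inj.
Qed.

Let f_sum1 n (ins : n.-tuple I) : \sum_(t \in [set: n.+1.-tuple O]) f ins t = 1.
Proof. by rewrite -mulr_fsumr proc_head_marginal mulVf ?gt_eqF. Qed.

Lemma shift_exists : exists q : csp R I O, is_shift i o p q.
Proof.
pose k n : kernel R (n.-tuple I) (n.+1.-tuple O) :=
  fun ins => FDist (f_ge0 ins) (f_finite ins) (f_sum1 ins).
have kC n (ins : n.-tuple I) iN (t : n.+1.-tuple O) :
    \sum_(a \in [set: O]) k n.+1 [tuple of rcons ins iN] [tuple of rcons t a]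
    = k n ins t.
  rewrite /= -mulr_fsumr; congr (_ * _).
  rewrite -(proc_consistent p [tuple of i :: ins] iN).
  by apply: eq_fsbigr => a _; congr (proc p _ _); exact: val_inj.
by exists (Csp kC).
Qed.

End Shift.

Lemma shift_unique i o p q q' : is_shift i o p q -> is_shift i o p q' -> q = q'.
Proof. by move=> pq pq'; apply: csp_ext => n ins t; rewrite pq pq'. Qed.

Lemma update_exists : exists u : kernel R (O * I * csp R I O)%type (csp R I O),
  is_update u.
Proof.
suff /choice[g gP] : forall x : O * I * csp R I O, exists q,
    0 < first_output x.2 x.1.1 -> is_shift x.1.2 x.1.1 x.2 q.
  by exists (detk R g) => o i p po; exists (g (o, i, p)); split=> //; exact: gP.
move=> [[o i] p] /=.
have [/(shift_exists i)[q pq]|_] := boolP (0 < first_output p o).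
  by exists q.
by exists p.
Qed.

End Processes.

(** * The behaviour of a deterministic transition system *)

Section Behaviour.
Variables (R : realType) (I O S : choiceType).
Variables (r : kernel R S O) (next : O -> I -> S -> S).

Definition cons_dist n (p : fdist R O) (k : O -> fdist R (n.-tuple O)) :
    fdist R (n.+1.-tuple O) :=
  image_dist (fun x : O * n.-tuple O => [tuple of x.1 :: x.2]) (joint p k).

Lemma cons_distE n (p : fdist R O) (k : O -> fdist R (n.-tuple O))
    (o : O) (t : n.-tuple O) :
  cons_dist p k [tuple of o :: t] = p o * k o t.
Proof.
rewrite /cons_dist (image_distE (h := fun x : O * n.-tuple O =>
  [tuple of x.1 :: x.2]) _ (o, t)) ?jointE// => -[a x] [b y] /= [-> xy].
by congr (_, _); exact: val_inj.
Qed.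

(** Each output is drawn from the readout of the current state; it is drawn
    before the next input is read, which is why one more output than inputs is
    produced. *)
Fixpoint behaviour_proc n (s : S) : n.-tuple I -> fdist R (n.+1.-tuple O) :=
  match n with
  | 0 => fun=> cons_dist (r s) (fun=> dirac R [tuple])
  | n'.+1 => fun ins => cons_dist (r s)
      (fun o => behaviour_proc (next o (thead ins) s) [tuple of behead ins])
  end.

Lemma behaviour_proc0 s (ins : 0.-tuple I) o :
  behaviour_proc s ins [tuple o] = r s o.
Proof.
by rewrite [LHS](cons_distE _ _ o [tuple]) /= ?eqxx mulr1.
Qed.

Lemma behaviour_procS n s i (ins : n.-tuple I) o (t : n.+1.-tuple O) :
  behaviour_proc s [tuple of i :: ins] [tuple of o :: t] =
  r s o * behaviour_proc (next o i s) ins t.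
Proof.
rewrite [LHS]cons_distE theadE; congr (_ * behaviour_proc _ _ _).
exact: val_inj.
Qed.

Lemma behaviour_consistent n s (ins : n.-tuple I) iN (t : n.+1.-tuple O) :
  \sum_(a \in [set: O])
    behaviour_proc s [tuple of rcons ins iN] [tuple of rcons t a] =
  behaviour_proc s ins t.
Proof.
elim: n s ins t => [|n IH] s ins t.
  case/tupleP: t => o t; rewrite [t]tuple0 behaviour_proc0.
  transitivity (\sum_(a \in [set: O]) (r s o * r (next o iN s) a)).
    apply: eq_fsbigr => a _.
    rewrite -(behaviour_proc0 (next o iN s) [tuple]) -behaviour_procS.
    rewrite [ins]tuple0; congr (behaviour_proc s _ _); exact: val_inj.
  by rewrite -mulr_fsumr pmf_sum1 mulr1.
case/tupleP: ins => i ins; case/tupleP: t => o t.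
rewrite behaviour_procS -IH mulr_fsumr; apply: eq_fsbigr => a _.
by rewrite -behaviour_procS; congr (behaviour_proc s _ _); exact: val_inj.
Qed.

Definition behaviour s : csp R I O :=
  Csp (fun n ins iN t => @behaviour_consistent n s ins iN t).

Lemma first_output_behaviour s o : first_output (behaviour s) o = r s o.
Proof. exact: behaviour_proc0. Qed.

Lemma behaviour_shift i o s : 0 < r s o ->
  is_shift i o (behaviour s) (behaviour (next o i s)).
Proof.
move=> ro n ins t; rewrite first_output_behaviour [in RHS]behaviour_procS.
by rewrite mulKf ?gt_eqF.
Qed.

(** The law of [o :: t] is the first output law at [o] times the law of [t] in
    the process conditioned on [o], so the two hypotheses allow an induction on
    the length. *)
Lemma behaviour_unique (h : S -> csp R I O) :
  (forall s o, first_output (h s) o = r s o) ->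
  (forall i o s, 0 < r s o -> is_shift i o (h s) (h (next o i s))) ->
  h = behaviour.
Proof.
move=> hr hS; apply/funext => s; apply: csp_ext => n.
elim: n s => [|n IH] s ins t.
  case/tupleP: t => o t; rewrite [t]tuple0 [ins]tuple0.
  by rewrite [LHS]hr [RHS]behaviour_proc0.
case/tupleP: ins => i ins; case/tupleP: t => o t.
(* An impossible first output makes both sides vanish. *)
have [ro|] := boolP (0 < r s o); last first.
  rewrite lt0r pmf_ge0 andbT negbK => /eqP r0.
  by rewrite !proc_head_eq0// ?first_output_behaviour ?hr.
apply: (mulfI (x := (first_output (h s) o)^-1)).
  by rewrite hr invr_eq0 gt_eqF.
rewrite -hS// IH (behaviour_shift i)//.
by rewrite first_output_behaviour hr.
Qed.

End Behaviour.

(** * The terminal machine *)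

Section Terminal.
Variables (R : realType) (I O : choiceType).

(** The current state [s] is the default value of [next] at outputs that are
    impossible in [s]. *)
Lemma unifilar_next (M : comb R I O) : unifilar M ->
  exists next : O -> I -> state M -> state M, forall i s o s',
    step M (i, s) (o, s') = readout M s o * (s' == next o i s)%:R.
Proof.
move=> /(deterministic_given_next snd)[h hE].
exists (fun o i s => h o (i, s)) => i s o s'.
by rewrite hE ((readoutE _ _).1 (stepP M)).
Qed.

Lemma comp_id_detkE (A X Y Z : choiceType) (f : kernel R A (X * Y)%type)
    (h : Y -> Z) a x (m : R) y0 z :
  (forall y, f a (x, y) = m * (y == y0)%:R) ->
  (f ;; (idk R X ⊗ detk R h)) a (x, z) = m * (z == h y0)%:R.
Proof.
move=> fE; rewrite /= (@fsum_single _ _ (x, y0)) => [|[x' y] xy].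
  by rewrite fE /= !eqxx mulr1 mul1r.
rewrite /=; have [xx|_] := eqVneq x x'; last by rewrite mul0r mulr0.
rewrite -xx fE; have [yy|_] := eqVneq y y0; last by rewrite mulr0 mul0r.
by rewrite xx yy eqxx in xy.
Qed.

Definition csp_readout : kernel R (csp R I O) O :=
  fun p => image_dist (@thead 0 O) (proc p [tuple]).

Lemma csp_readoutE p o : csp_readout p o = first_output p o.
Proof.
rewrite /csp_readout -[o in LHS](theadE o [tuple]) image_distE// => x y.
case/tupleP: x => a x; case/tupleP: y => b y.
by rewrite !theadE [x]tuple0 [y]tuple0 => ->.
Qed.

Variable u : kernel R (O * I * csp R I O)%type (csp R I O).

Definition csp_step : kernel R (I * csp R I O)%type (O * csp R I O)%type :=
  fun x => joint (csp_readout x.2) (fun o => u (o, x.1, x.2)).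

Lemma csp_stepE i p o q :
  csp_step (i, p) (o, q) = csp_readout p o * u (o, i, p) q.
Proof. exact: jointE. Qed.

Lemma csp_step_marginal i p o : marginal csp_step (i, p) o = csp_readout p o.
Proof.
rewrite marginalE; under eq_fsbigr do rewrite csp_stepE.
by rewrite -mulr_fsumr pmf_sum1 mulr1.
Qed.

Lemma csp_step_readout : is_readout csp_step csp_readout.
Proof. by apply/readoutE => i p o; exact: csp_step_marginal. Qed.

Hypothesis uP : is_update u.

Lemma csp_step_unifilar : unifilar (Comb csp_step_readout).
Proof.
apply: (deterministic_given_intro
  (c := fun x : O * (I * csp R I O) => u (x.1, x.2.1, x.2.2))).
  by move=> [i p] o q; rewrite csp_step_marginal [LHS]csp_stepE.
move=> [i p] o; rewrite csp_step_marginal => ro.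
have [|q [_ uq]] := uP i (p := p) (o := o); last by exists q.
by rewrite -csp_readoutE lt0r ro pmf_ge0.
Qed.

(** For [h] preserving readouts, the step equation compares [readout (o | s)] at the process
    [h (next o i s)] with [readout (o | s)] at [(h s)^(i,o)]. Hence it holds
    exactly when these processes agree at every possible [o], which gives
    existence and uniqueness from the two properties of [behaviour]. *)
Lemma csp_terminal :
  @terminal (UnifilarCombCat R I O) (UnifilarComb csp_step_unifilar).
Proof.
move=> M; have [next nextE] := unifilar_next (unifilarP M).
pose b := behaviour (readout M) next.
have b_step :
    step M ;; (idk R O ⊗ detk R b) = (idk R I ⊗ detk R b) ;; csp_step.
  apply: kernel_pair_ext => -[i s] o q.
  rewrite (comp_id_detkE _ _ (nextE i s o)) tensor_detk detk_comp csp_stepE.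
  rewrite csp_readoutE first_output_behaviour.
  have [->|ro] := eqVneq (readout M s o) 0; first by rewrite !mul0r.
  have {}ro : 0 < readout M s o by rewrite lt0r ro pmf_ge0.
  have [|q' [bq' ->]] := uP i (p := b s) (o := o).
    by rewrite first_output_behaviour.
  by rewrite (shift_unique bq' (behaviour_shift next i ro)).
have b_readout : detk R b ;; csp_readout = readout M.
  apply: kernel_ext => s o.
  by rewrite detk_comp [LHS]csp_readoutE first_output_behaviour.
exists (@CombHom _ _ _ M (UnifilarComb csp_step_unifilar) _
  (detk_deterministic R b) b_step b_readout).
move=> g; apply: comb_hom_ext => /=.
have [h gh] := deterministic_detk (hom_det g).
rewrite gh; congr (detk R _).
have hr s o : first_output (h s) o = readout M s o.
  by rewrite -(hom_readout g) gh detk_comp [RHS]csp_readoutE.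
apply: behaviour_unique => // i o s ro.
have [|q [hq uq]] := uP i (p := h s) (o := o); first by rewrite hr.
(* Compare the masses that both sides of the step equation give to [(o, q)],
   where [q] is the conditioned process: the right one is positive, and the
   left one vanishes unless [q = h (next o i s)]. *)
suff <- : q = h (next o i s) by [].
have : (step M ;; (idk R O ⊗ g)) (i, s) (o, q) =
       ((idk R I ⊗ g) ;; csp_step) (i, s) (o, q) by rewrite (hom_step g).
rewrite gh (comp_id_detkE _ _ (nextE i s o)) tensor_detk detk_comp.
rewrite csp_stepE csp_readoutE hr uq.
move/(mulfI (lt0r_neq0 ro)); rewrite /= eqxx.
by case: eqP => // _ /esym/eqP; rewrite oner_eq0.
Qed.

End Terminal.

Theorem proposition3p2 (R : realType) (I O : choiceType) :
  (exists u : kernel R (O * I * csp R I O)%type (csp R I O), is_update u) /\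
  forall u : kernel R (O * I * csp R I O)%type (csp R I O), is_update u ->
    exists (w : kernel R (I * csp R I O)%type (O * csp R I O)%type)
           (r : kernel R (csp R I O) O),
      (forall (p : csp R I O) (o : O), r p o = first_output p o) /\
      (forall (i : I) (p : csp R I O) (o : O) (q : csp R I O),
         w (i, p) (o, q) = r p o * u (o, i, p) q) /\
      exists (wP : is_readout w r) (wU : unifilar (Comb wP)),
        @terminal (UnifilarCombCat R I O) (UnifilarComb wU).
Proof.
split; first exact: update_exists.
move=> u uP; exists (csp_step u), (@csp_readout R I O).
split; first exact: csp_readoutE.
split; first exact: csp_stepE.
exists (csp_step_readout u), (csp_step_unifilar uP); exact: csp_terminal.
Qed.
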